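(* Let $\{\mu_x\}_{x\in\mathbb{R}^N}$ be a family of Lévy measures on $\mathbb{R}^N$ for which there is a constant $\tilde C_\mu>0$ with $\int_B|z|^2\mu_x(dz)+\int_{\mathbb{R}^N\setminus B}\mu_x(dz)\le \tilde C_\mu$ for every $x\in\mathbb{R}^N$. Let $F:\mathbb{R}^N\times[0,T]\times\mathbb{R}^N\times\mathbb{S}^N\times\mathbb{R}\to\mathbb{R}$ be continuous and degenerate elliptic, and such that for all $x\in\mathbb{R}^N$, $t\in[0,T]$, $l\in\mathbb{R}$, $$F(x,t,0,O,l)\le 0\ \Rightarrow\ l\ge 0 .$$ Let $u\in USC(\mathbb{R}^N\times[0,T])$ be a viscosity subsolution of $$u_t+F(x,t,Du,D^2u,\mathcal{I}[x,t,u])=0\quad\text{in }\mathbb{R}^N\times(0,T).$$ If $u$ attains a global maximum at $(x_0,t_0)\in\mathbb{R}^N\times(0,T)$, then $u(\cdot,t_0)$ is constant on $\overline{\bigcup_{n\ge0}A_n}$, where $$A_0=\{x_0\},\qquad A_{n+1}=\bigcup_{x\in A_n}\big(x+\mathrm{supp}(\mu_x)\big).$$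
   Context: $T>0$; $\mathbb{S}^N$ is the set of real symmetric $N\times N$ matrices, $O$ the zero matrix; $B$ is the unit ball $\{|z|<1\}$ of $\mathbb{R}^N$ and $1_B$ its indicator function. A family of Lévy measures $\{\mu_x\}$ is a family of nonnegative, possibly singular, Borel measures on $\mathbb{R}^N$ with $\sup_x\int_{\mathbb{R}^N}\min(|z|^2,1)\,\mu_x(dz)<\infty$; $\mathrm{supp}(\mu_x)$ is the support of $\mu_x$. $USC(\mathbb{R}^N\times[0,T])$ is the set of upper semicontinuous real functions on $\mathbb{R}^N\times[0,T]$. $Du,D^2u$ denote gradient and Hessian in $x$. Degenerate elliptic: $F(x,t,p,X,l_1)\le F(x,t,p,Y,l_2)$ whenever $X\ge Y$, $l_1\ge l_2$, for all $x,t$, $p\in\mathbb{R}^N\setminus\{0\}$, $X,Y\in\mathbb{S}^N$, $l_1,l_2\in\mathbb{R}$. Nonlocal operator: $\mathcal{I}[x,t,u]=\int_{\mathbb{R}^N}\big(u(x+z,t)-u(x,t)-Du(x,t)\cdot z\,1_B(z)\big)\mu_x(dz)$. For $0<\delta<1$ and $p\in\mathbb{R}^N$ put $\mathcal{I}^1_\delta[x,t,u]=\int_{|z|\le\delta}\big(u(x+z,t)-u(x,t)-Du(x,t)\cdot z\,1_B(z)\big)\mu_x(dz)$ and $\mathcal{I}^2_\delta[x,t,p,u]=\int_{|z|>\delta}\big(u(x+z,t)-u(x,t)-p\cdot z\,1_B(z)\big)\mu_x(dz)$. Viscosity subsolution in $\Omega\times(0,T)$ (here $\Omega=\mathbb{R}^N$):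 an upper semicontinuous $u:\mathbb{R}^N\times[0,T]\to\mathbb{R}$ such that for every $\phi\in C^2(\mathbb{R}^N\times[0,T])$ for which $u-\phi$ attains a global maximum at $(x,t)\in\Omega\times(0,T)$, and every $0<\delta<1$, $$\phi_t(x,t)+F\big(x,t,D\phi(x,t),D^2\phi(x,t),\mathcal{I}^1_\delta[x,t,\phi]+\mathcal{I}^2_\delta[x,t,D\phi(x,t),u]\big)\le0.$$ *)

(* Defs.v *)
From HB Require Import structures.
From mathcomp Require Import all_boot all_order all_algebra.
From mathcomp Require Import all_classical all_reals all_analysis.

Set Implicit Arguments.
Unset Strict Implicit.
Unset Printing Implicit Defensive.

Import Order.TTheory GRing.Theory Num.Theory.
Import numFieldNormedType.Exports.

Local Open Scope classical_set_scope.
Local Open Scope ring_scope.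

(* Functions on R^N x [0,T], and F on R^N x [0,T] x R^N x S^N x R, are total
   functions on the ambient spaces; every condition imposed on them only
   involves their values at times in [0,T] (and at symmetric matrices). *)

Section euclidean.
Context {R : realType} {N : nat}.
Implicit Types (x z p v : 'rV[R]_N) (X Y : 'M[R]_N).

Definition edot p z : R := \sum_(i < N) p 0 i * z 0 i.

(* The library norm `|z| on 'rV[R]_N is the max norm, hence this one. *)
Definition enorm z : R := Num.sqrt (edot z z).

Definition unit_ball : set 'rV[R]_N := [set z | enorm z < 1].

Definition symmetric_mx X : Prop := X^T = X.

Definition loewner_le Y X : Prop :=
  forall v, edot (v *m Y) v <= edot (v *m X) v.

End euclidean.

Notation borelRn R N := (g_sigma_algebraType (@open 'rV[R]_N)).

Section levy.
Context {R : realType} {N : nat}.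
Implicit Types mu : 'rV[R]_N -> {measure set (borelRn R N) -> \bar R}.

Definition levy_family mu : Prop :=
  (ereal_sup [set \int[mu x]_z (Num.min (enorm z ^+ 2) 1)%:E
             | x in [set: 'rV[R]_N]] < +oo)%E.

Definition msupport (m : {measure set (borelRn R N) -> \bar R})
    : set 'rV[R]_N :=
  [set z | forall U : set 'rV[R]_N, open U -> U z -> (0 < m U)%E].

Fixpoint reach mu (x0 : 'rV[R]_N) (n : nat) : set 'rV[R]_N :=
  if n is n'.+1 then
    \bigcup_(x in reach mu x0 n') [set x + z | z in msupport (mu x)]
  else [set x0].

End levy.

Section time_slab.
Context {R : realType} {N : nat}.
Variable T : R.
Implicit Types (u phi : 'rV[R]_N * R -> R) (q : 'rV[R]_N * R).

Definition slab : set ('rV[R]_N * R) := [set: 'rV[R]_N] `*` `[0, T]%classic.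
Definition oslab : set ('rV[R]_N * R) := [set: 'rV[R]_N] `*` `]0, T[%classic.

Definition usc u : Prop :=
  forall q, slab q -> forall a : R, u q < a ->
    \forall q' \near within slab (nbhs q), u q' < a.

Definition global_max u q : Prop := forall q', slab q' -> u q' <= u q.

Definition continuous_up_to_slab (f : 'rV[R]_N * R -> R) : Prop :=
  exists2 g : 'rV[R]_N * R -> R,
    {within slab, continuous g} & forall q, oslab q -> f q = g q.

(* C^2 up to the boundary times 0 and T: the derivatives of order <= 2 exist
   in the open slab and extend continuously to the closed one. *)
Definition C2 phi : Prop :=
  [/\ {within slab, continuous phi},
      forall v q, oslab q -> derivable phi q v,
      forall v, continuous_up_to_slab ('D_v phi),
      forall v w q, oslab q -> derivable ('D_v phi) q w
    & forall v w, continuous_up_to_slab ('D_w ('D_v phi))].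

Definition dir_x (i : 'I_N) : 'rV[R]_N * R := (delta_mx 0 i, 0).
Definition dir_t : 'rV[R]_N * R := (0, 1).

Definition dt phi q : R := 'D_dir_t phi q.
Definition grad phi q : 'rV[R]_N := \row_i 'D_(dir_x i) phi q.
Definition hess phi q : 'M[R]_N :=
  \matrix_(i, j) 'D_(dir_x i) ('D_(dir_x j) phi) q.

End time_slab.

Section nonlocal.
Context {R : realType} {N : nat}.
Variable mu : 'rV[R]_N -> {measure set (borelRn R N) -> \bar R}.
Implicit Types (x z p : 'rV[R]_N) (t delta : R) (u phi : 'rV[R]_N * R -> R).

Definition compensated u x t p z : R :=
  u (x + z, t) - u (x, t) - edot p z * \1_unit_ball z.

Definition I1 delta x t u : \bar R :=
  (\int[mu x]_(z in [set z | (enorm z <= delta)%R])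
     (compensated u x t (grad u (x, t)) z)%:E)%E.

Definition I2 delta x t p u : \bar R :=
  (\int[mu x]_(z in [set z | (delta < enorm z)%R])
     (compensated u x t p z)%:E)%E.

End nonlocal.

Section equation.
Context {R : realType} {N : nat}.
Variable T : R.
Variable F : 'rV[R]_N -> R -> 'rV[R]_N -> 'M[R]_N -> R -> R.

Definition F_domain : set ('rV[R]_N * R * 'rV[R]_N * 'M[R]_N * R) :=
  [set a | 0 <= a.1.1.1.2 <= T /\ symmetric_mx a.1.2].

Definition F_continuous : Prop :=
  {within F_domain, continuous (fun a : 'rV[R]_N * R * 'rV[R]_N * 'M[R]_N * R =>
     F a.1.1.1.1 a.1.1.1.2 a.1.1.2 a.1.2 a.2)}.

Definition degenerate_elliptic : Prop :=
  forall (x : 'rV[R]_N) (t : R) (p : 'rV[R]_N) (X Y : 'M[R]_N) (l1 l2 : R),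
    0 <= t <= T -> p != 0 ->
    symmetric_mx X -> symmetric_mx Y -> loewner_le Y X -> l2 <= l1 ->
    F x t p X l1 <= F x t p Y l2.

(* F takes a real last argument, so the inequality includes the requirement
   that I1 + I2 be finite; with the library's conventions on infinite integrals
   this means that the positive and negative parts of both integrands have
   finite integrals. *)
Definition viscosity_subsolution
    (mu : 'rV[R]_N -> {measure set (borelRn R N) -> \bar R})
    (u : 'rV[R]_N * R -> R) : Prop :=
  usc T u /\
  forall phi : 'rV[R]_N * R -> R, C2 T phi ->
  forall (x : 'rV[R]_N) (t : R), 0 < t < T -> global_max T (fun q => u q - phi q) (x, t) ->
  forall delta : R, 0 < delta < 1 ->
  exists2 l : R,
    (I1 mu delta x t phi + I2 mu delta x t (grad phi (x, t)) u)%E = l%:E &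
    dt phi (x, t) + F x t (grad phi (x, t)) (hess phi (x, t)) l <= 0.

End equation.

(* Main.v *)
Require Import Defs.
From mathcomp Require Import all_boot all_order all_algebra.
From mathcomp Require Import all_classical all_reals all_analysis.
Import Order.TTheory GRing.Theory Num.Theory.
Import numFieldNormedType.Exports.
Local Open Scope classical_set_scope.
Local Open Scope ring_scope.

(** At a global maximum point [(x, t)] of [u] with [0 < t < T], the zero
    function is an admissible test function.  All its derivatives vanish, so
    the subsolution inequality at that point reads [F x t 0 0 l <= 0], where [l]
    is the integral of [u (x + z, t) - u (x, t)] over [|z| > delta] against
    [mu x]; hence [0 <= l].  The integrand is nonpositive since [u] is maximal
    at [(x, t)].  If it were negative at some [z] in the support of [mu x], then
    by upper semicontinuity it would stay below some [- c < 0] on an open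
    neighbourhood of [z], which can be taken inside [|z| > delta] for small
    [delta] because [z != 0]; that neighbourhood has positive mass, so [l]
    would be negative.  Hence the maximum propagates from [x] to
    [x + supp (mu x)] ([max_propagates_to_support]), and by induction to all
    the sets [reach mu x0 n].  Upper semicontinuity extends the equality with
    the maximum to the closure of their union. *)

Section nonneg_integral.
Local Open Scope ereal_scope.
Context {d : measure_display} {X : measurableType d} {R : realType}.
Variable mu : {measure set X -> \bar R}.

(** The integral of a nonnegative function is a supremum over the simple
    functions below it, so monotonicity needs no measurability. *)
Lemma ge0_le_integral_nomeas (D : set X) (f g : X -> \bar R) :
  (forall x, D x -> 0 <= f x) -> (forall x, D x -> f x <= g x) ->
  \int[mu]_(x in D) f x <= \int[mu]_(x in D) g x.
Proof.
move=> f0 fg.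
have g0 x : D x -> 0 <= g x by move=> Dx; exact: le_trans (f0 _ Dx) (fg _ Dx).
rewrite !ge0_integralE//; apply: le_ereal_sup => _ [h hf <-].
exists h => // x; apply: le_trans (hf x) _.
by rewrite /patch; case: ifPn => // /set_mem; exact: fg.
Qed.

(** A Markov-type bound for functions that need not be measurable. *)
Lemma ge0_cst_le_integral (D A : set X) (g : X -> \bar R) (c : R) :
  measurable A -> A `<=` D -> (0 <= c)%R ->
  (forall x, D x -> 0 <= g x) -> (forall x, A x -> c%:E <= g x) ->
  c%:E * mu A <= \int[mu]_(x in D) g x.
Proof.
move=> mA AD c0 g0 cg.
rewrite -integral_cst// -(setIidr AD) integral_mkcondr.
apply: ge0_le_integral_nomeas => x Dx; rewrite /patch; case: ifPn => //.
- by move=> /set_mem Ax; exact: cg.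
- by move=> _; exact: g0.
Qed.

End nonneg_integral.

Section euclidean_norm.
Context {R : realType} {N : nat}.

Lemma edot0l (z : 'rV[R]_N) : edot 0 z = 0.
Proof. by rewrite /edot big1// => i _; rewrite mxE mul0r. Qed.

Lemma enorm_gt0 (z : 'rV[R]_N) : z != 0 -> 0 < enorm z.
Proof.
move=> z0; rewrite sqrtr_gt0 lt_def sumr_ge0 ?andbT; last first.
  by move=> i _; rewrite -expr2 sqr_ge0.
apply: contra z0 => /eqP /psumr_eq0P zz.
apply/eqP/rowP => i; rewrite mxE; apply/eqP.
rewrite -sqrf_eq0 expr2; apply/eqP/zz => // j _.
by rewrite -expr2 sqr_ge0.
Qed.

Lemma enorm_continuous : continuous (@enorm R N).
Proof.
move=> z; apply: continuous_comp; last exact: sqrt_continuous.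
rewrite /edot; apply: continuous_big => [|i _ w]; first exact: add_continuous.
by apply: (@continuousM _ 'rV[R]_N); exact: coord_continuous.
Qed.

Lemma open_enorm_gt (delta : R) : open [set z : 'rV[R]_N | delta < enorm z].
Proof.
by apply: (@open_comp _ _ (@enorm R N) [set r | delta < r]);
  [move=> z _; exact: enorm_continuous | exact: open_gt].
Qed.

End euclidean_norm.

Section zero_test_function.
Context {R : realType} {N : nat}.
Variable T : R.

Lemma derive_zero (v : 'rV[R]_N * R) :
  'D_v (fun _ : 'rV[R]_N * R => 0 : R) = fun _ => 0.
Proof. by apply/funext => q; exact: derive_cst. Qed.

Lemma continuous_up_to_slab0 :
  continuous_up_to_slab T (fun _ : 'rV[R]_N * R => 0 : R).
Proof. by exists (fun _ => 0) => // q; exact: cvg_cst. Qed.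

Lemma C2_zero : C2 T (fun _ : 'rV[R]_N * R => 0 : R).
Proof.
split.
- by move=> q; exact: cvg_cst.
- by move=> v q _; exact: derivable_cst.
- by move=> v; rewrite derive_zero; exact: continuous_up_to_slab0.
- by move=> v w q _; rewrite derive_zero; exact: derivable_cst.
- by move=> v w; rewrite !derive_zero; exact: continuous_up_to_slab0.
Qed.

Lemma dt_zero (q : 'rV[R]_N * R) : dt (fun _ => 0) q = 0.
Proof. by exact: derive_cst. Qed.

Lemma grad_zero (q : 'rV[R]_N * R) : grad (fun _ => 0) q = 0.
Proof. by apply/rowP => i; rewrite !mxE; exact: derive_cst. Qed.

Lemma hess_zero (q : 'rV[R]_N * R) : hess (fun _ => 0) q = 0.
Proof. by apply/matrixP => i j; rewrite !mxE derive_zero; exact: derive_cst. Qed.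

Lemma I1_zero (mu : 'rV[R]_N -> {measure set (borelRn R N) -> \bar R})
    (delta t : R) (x : 'rV[R]_N) : I1 mu delta x t (fun _ => 0) = 0%E.
Proof.
rewrite /I1 -[RHS](integral0 (mu x) [set z | enorm z <= delta]).
apply: eq_integral => z _.
by rewrite /compensated grad_zero edot0l mul0r !subr0.
Qed.

End zero_test_function.

Section propagation.
Context {R : realType} {N : nat}.
Variables (T : R) (u : 'rV[R]_N * R -> R).
Hypothesis husc : usc T u.

Lemma usc_lt_space (t a : R) (x : 'rV[R]_N) : 0 <= t <= T -> u (x, t) < a ->
  \forall y \near x, u (y, t) < a.
Proof.
move=> tT ua.
have slabt y : slab T ((y, t) : 'rV[R]_N * R) by split => //=; rewrite in_itv.
have : (fun y : 'rV[R]_N => (y, t)) @ x --> (x, t).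
  by apply: (@cvg_pair _ _ _ (nbhs x) (nbhs x) (nbhs t));
    [exact: cvg_id | exact: cvg_cst].
move=> /(_ _ (husc _ (slabt x) _ ua)) uy.
have {}uy : \forall y \near x, slab T (y, t) -> u (y, t) < a by exact: uy.
by near=> y; apply: (near uy y) => //; exact: slabt.
Unshelve. all: by end_near.
Qed.

Variable mu : 'rV[R]_N -> {measure set (borelRn R N) -> \bar R}.
Variable F : 'rV[R]_N -> R -> 'rV[R]_N -> 'M[R]_N -> R -> R.
Hypothesis hF0 : forall (x : 'rV[R]_N) (t l : R), 0 <= t <= T ->
  F x t 0 0 l <= 0 -> 0 <= l.
Hypothesis hu : viscosity_subsolution T F mu u.

(** The subsolution inequality tested with the zero function: at a maximum
    point of [u] the nonlocal term outside the [delta]-ball is nonnegative. *)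
Lemma I2_ge0_at_max (x : 'rV[R]_N) (t delta : R) :
  0 < t < T -> global_max T u (x, t) -> 0 < delta < 1 ->
  (0 <= I2 mu delta x t 0 u)%E.
Proof.
move=> tT xmax hdelta; have [_ sub] := hu.
have max0 : global_max T (fun q => u q - 0) (x, t).
  by move=> q /xmax; rewrite !subr0.
have [l] := sub _ (@C2_zero R N T) x t tT max0 _ hdelta.
rewrite I1_zero add0e grad_zero hess_zero dt_zero add0r => -> Fl.
rewrite lee_fin; apply: hF0 Fl.
by case/andP: tT => /ltW -> /ltW ->.
Qed.

Lemma max_propagates_to_support (x z : 'rV[R]_N) (t : R) :
  0 < t < T -> global_max T u (x, t) -> msupport (mu x) z ->
  u (x + z, t) = u (x, t).
Proof.
move=> tT xmax zsupp.
have tT' : 0 <= t <= T by case/andP: tT => /ltW -> /ltW ->.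
have slabt y : slab T ((y, t) : 'rV[R]_N * R) by split => //=; rewrite in_itv.
apply/eqP; rewrite eq_le xmax//= leNgt; apply/negP => uz.
have z0 : z != 0 by apply: contraTneq uz => ->; rewrite addr0 ltxx.
(* Half of min (|z|, 1), so that [0 < delta < 1] and [delta < |z|]. *)
pose delta := Num.min (enorm z) 1 / 2.
have m0 : 0 < Num.min (enorm z) 1 by rewrite lt_min enorm_gt0//=.
have delta_lt : delta < Num.min (enorm z) 1 by rewrite ltr_pdivrMr// ltr_pMr// ltr1n.
have /andP[delta_z delta1] : (delta < enorm z) && (delta < 1).
  by rewrite -lt_min.
have hdelta : 0 < delta < 1 by rewrite delta1 divr_gt0.
(* A level strictly between the value at [x + z] and the maximum. *)
pose a := (u (x + z, t) + u (x, t)) / 2.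
have uza : u (x + z, t) < a by rewrite midf_lt.
have au : a < u (x, t) by rewrite midf_lt.
pose A := [set w | delta < enorm w] `&` [set w | u (x + w, t) < a]°.
have oA : open A by apply: openI; [exact: open_enorm_gt | exact: open_interior].
have Az : A z.
  split=> //; rewrite /interior.
  have : (fun w : 'rV[R]_N => x + w) @ z --> x + z.
    by apply: (@cvgD _ 'rV[R]_N _ (nbhs z)); [exact: cvg_cst | exact: cvg_id].
  by move=> /(_ _ (usc_lt_space _ _ _ tT' uza)).
have mA : measurable (A : set (borelRn R N)) by exact: sub_sigma_algebra.
pose c := u (x, t) - a.
have c0 : 0 < c by rewrite subr_gt0.
have muA : (0 < c%:E * mu x A)%E by rewrite mule_gt0 ?lte_fin//; exact: zsupp.
pose f w := (compensated u x t 0 w)%:E.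
have fE w : f w = (u (x + w, t) - u (x, t))%:E.
  by rewrite /f /compensated edot0l mul0r subr0.
have f0 w : (f w <= 0)%E by rewrite fE lee_fin subr_le0; exact: xmax.
(* The integrand has constant sign, so the minus sign comes out of the
   integral whatever its value and its measurability. *)
have I2E : I2 mu delta x t 0 u =
    (- \int[mu x]_(w in [set w | (delta < enorm w)%R]) (- f w))%E.
  rewrite -integral_ge0N => [|w _]; last by rewrite oppe_ge0.
  by apply: eq_integral => w _; rewrite oppeK.
have := I2_ge0_at_max _ _ _ tT xmax hdelta.
apply/negP; rewrite -ltNge I2E oppe_lt0.
apply: lt_le_trans muA _; apply: ge0_cst_le_integral => //.
- by move=> w [].
- exact: ltW.
- by move=> w _; rewrite oppe_ge0.
- move=> w [_ /interior_subset wa].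
  by rewrite fE -EFinN lee_fin opprB lerB// ltW.
Qed.

End propagation.

Theorem theorem2 (R : realType) (N : nat) (hN : (0 < N)%N)
  (T : R) (hT : 0 < T)
  (mu : 'rV[R]_N -> {measure set (borelRn R N) -> \bar R})
  (hmu : levy_family mu)
  (hCmu : exists2 C : R, 0 < C & forall x : 'rV[R]_N,
     (\int[mu x]_(z in unit_ball) (enorm z ^+ 2)%:E
      + \int[mu x]_(z in ~` unit_ball) 1 <= C%:E)%E)
  (F : 'rV[R]_N -> R -> 'rV[R]_N -> 'M[R]_N -> R -> R)
  (hFcont : F_continuous T F)
  (hFell : degenerate_elliptic T F)
  (hF0 : forall (x : 'rV[R]_N) (t l : R), 0 <= t <= T ->
     F x t 0 0 l <= 0 -> 0 <= l)
  (u : 'rV[R]_N * R -> R)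
  (husc : usc T u)
  (hu : viscosity_subsolution T F mu u)
  (x0 : 'rV[R]_N) (t0 : R) (ht0 : 0 < t0 < T)
  (hmax : global_max T u (x0, t0)) :
  forall x y : 'rV[R]_N,
    closure (\bigcup_n reach mu x0 n) x ->
    closure (\bigcup_n reach mu x0 n) y ->
    u (x, t0) = u (y, t0).
Proof.
have ht0' : 0 <= t0 <= T by case/andP: ht0 => /ltW -> /ltW ->.
have reachE n x : reach mu x0 n x -> u (x, t0) = u (x0, t0).
  elim: n x => [x -> //|n IHn _ [x /IHn ux] [z zsupp <-]].
  rewrite -ux (max_propagates_to_support _ _ husc _ _ hF0 hu)//.
  by move=> q /hmax; rewrite ux.
suff closureE x : closure (\bigcup_n reach mu x0 n) x -> u (x, t0) = u (x0, t0).
  by move=> x y /closureE -> /closureE ->.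
move=> clx; apply/eqP; rewrite eq_le hmax; last by split => //=; rewrite in_itv.
rewrite leNgt; apply/negP => ux.
have [y [[n _ /reachE ->]]] := clx _ (usc_lt_space _ _ husc _ _ _ ht0' ux).
by rewrite /= ltxx.
Qed.
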